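(* Let $\delta_{oct}$ be the Hausdorff dimension of the alphabet $\mathcal{A}_{oct}=8\mathbb{N}-7=\{1,9,17,\ldots\}$ and $\delta_{even}$ that of $\mathcal{A}_{even}=2\mathbb{N}=\{2,4,6,\ldots\}$, and let $\bar\delta=\max(\delta_{oct},\delta_{even})$. Then a finite alphabet $\mathcal{A}\subset\mathbb{N}$ has no local obstructions if $\delta_{\mathcal{A}}>\bar\delta$.
   Context: For an alphabet $\mathcal{A}\subset\mathbb{N}$, $\delta_{\mathcal{A}}$ is the Hausdorff dimension of the set of irrationals in $(0,1)$ whose continued fraction partial quotients all lie in $\mathcal{A}$. For $a\in\mathbb{N}$ let $\gamma_a=\begin{pmatrix}0&1\\1&a\end{pmatrix}$ and let $\mathcal{G}_{\mathcal{A}}$ be the semigroup generated by $\gamma_a$, $a\in\mathcal{A}$. Let $\mathfrak{D}_{\mathcal{A}}=\{\langle \gamma e_2,e_2\rangle:\gamma\in\mathcal{G}_{\mathcal{A}}\}$ (the denominators of rationals with all partial quotients in $\mathcal{A}$). An integer $d$ is admissible if for every $q\in\mathbb{N}$, $d\bmod q$ lies in $\mathfrak{D}_{\mathcal{A}}\bmod q$; $\mathcal{A}$ has no local obstructions if every integer is admissible. *)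

(* Defs.v *)
From HB Require Import structures.
From mathcomp Require Import all_boot all_order all_algebra.
From mathcomp Require Import all_classical all_reals all_analysis.
From mathcomp Require Import Rstruct Rstruct_topology.

Set Implicit Arguments. Unset Strict Implicit. Unset Printing Implicit Defensive.
Import Order.TTheory GRing.Theory Num.Theory.
Local Open Scope classical_set_scope.
Local Open Scope ring_scope.

Notation RR := Rdefinitions.R.

Definition gauss (x : RR) : RR := x^-1 - (Num.floor (x^-1))%:~R.

(* n-th partial quotient (n = 0 is the first one a_1):
   a_{n+1}(x) = floor (1 / T^n x). *)
Definition cf_digit (n : nat) (x : RR) : int := Num.floor ((iter n gauss x)^-1).

Definition irrational (x : RR) : Prop := forall q : rat, x != ratr q.

Definition E_alph (A : set nat) : set RR :=
  [set x | 0 < x < 1 /\ irrational x /\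
           forall n : nat, exists2 a : nat, A a & cf_digit n x = a%:Z].

(* diameter of a subset of R, with diam set0 = 0 *)
Definition diam (U : set RR) : \bar RR :=
  maxe 0%E (ereal_sup [set (`|x - y|)%:E | x in U & y in U]).

Definition hausdorff_delta (s delta : RR) (E : set RR) : \bar RR :=
  ereal_inf [set (\sum_(0 <= k <oo) poweR (diam (U k)) s)%E
            | U in [set U : nat -> set RR |
                    E `<=` \bigcup_k U k /\ forall k, (diam (U k) <= delta%:E)%E]].

(* H^s(E) = lim_{delta -> 0+} H^s_delta(E) = sup_{delta > 0} H^s_delta(E) *)
Definition hausdorff_measure (s : RR) (E : set RR) : \bar RR :=
  ereal_sup [set hausdorff_delta s delta E | delta in [set d : RR | 0 < d]].

Definition hausdorff_dim (E : set RR) : \bar RR :=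
  ereal_inf [set s%:E | s in [set s : RR | 0 <= s /\ hausdorff_measure s E = 0%E]].

Definition delta_alph (A : set nat) : \bar RR := hausdorff_dim (E_alph A).

Definition A_oct : set nat := [set n | exists k : nat, n = (8 * k + 1)%N].
Definition A_even : set nat := [set n | exists k : nat, n = (2 * k + 2)%N].

Definition gamma (a : nat) : 'M[int]_2 :=
  \matrix_(i < 2, j < 2) (if (i == 0%N :> nat) && (j == 0%N :> nat) then 0
                          else if (i == 1%N :> nat) && (j == 1%N :> nat) then a%:Z
                          else 1).

Definition semigroup_G (A : set nat) : set 'M[int]_2 :=
  [set g | exists s : seq nat, [/\ s != [::], (forall a, a \in s -> A a)
         & g = foldr (fun a m => gamma a *m m) 1%:M s]].

(* <gamma e2, e2> is the (2,2) entry *)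
Definition denoms (A : set nat) : set int :=
  [set (g 1 1) | g in semigroup_G A].

Definition admissible (A : set nat) (d : int) : Prop :=
  forall q : nat, (0 < q)%N ->
    exists2 d' : int, denoms A d' & (d' = d %[mod q%:Z])%Z.

Definition no_local_obstructions (A : set nat) : Prop :=
  forall d : int, admissible A d.

(* Main.v *)
Require Import Defs.
From HB Require Import structures.
From mathcomp Require Import all_boot all_order all_algebra.
From mathcomp Require Import all_classical all_reals all_analysis.
From mathcomp Require Import Rstruct Rstruct_topology.
From mathcomp Require Import ring lra zify.
Import Order.TTheory GRing.Theory Num.Theory.
Set Implicit Arguments. Unset Strict Implicit. Unset Printing Implicit Defensive.
Local Open Scope classical_set_scope.
Local Open Scope ring_scope.

(** If [phi] is injective on a finite alphabet [A] and [phi a <= a], replacing each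
    digit [a] by [phi a] can only contract distances by a bounded factor, so the
    dimension of [A] is at most that of [phi A].  Taking [phi a = 8 ((a-1)/8) + 1],
    which is injective when distinct digits differ by at least 8, and [phi a = 2 (a/2)],
    which is injective into the even alphabet when [1] is not a digit and no two digits
    are consecutive, the hypothesis on the dimension forces [A] to contain two digits
    [a] and [a + d] with [1 <= d <= 7], and moreover [1] or two consecutive digits.

    Modulo [q] the bottom rows of the matrices of the semigroup form an orbit of a
    finite group of permutations, stable under the shears [(x, y) -> (x, y + d x)] and
    [(x, y) -> (x + d y, y)].  If [d = 1] these reach every denominator.  Otherwise [1]
    is a digit, the orbit contains the pairs of consecutive Fibonacci numbers, and every
    residue modulo [d <= 7] is a Fibonacci number with a neighbour coprime to [d]; the
    shears correct it to any integer in its class modulo [d].  (Modulo 8 the Fibonacci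
    numbers miss 4 and 6.) *)

(** * Hausdorff dimension under expanding maps *)

Lemma diam_ge0 (U : set RR) : (0 <= diam U)%E.
Proof. by rewrite /diam le_max lexx. Qed.

Lemma le_diam (U : set RR) (x y : RR) : U x -> U y -> (`|x - y|%:E <= diam U)%E.
Proof.
move=> Ux Uy; rewrite /diam le_max; apply/orP; right.
by apply: ereal_sup_ubound; exists x => //; exists y.
Qed.

Lemma diam_le (U : set RR) (c : \bar RR) : (0 <= c)%E ->
  (forall x y, U x -> U y -> (`|x - y|%:E <= c)%E) -> (diam U <= c)%E.
Proof.
move=> c0 Uc; rewrite /diam ge_max c0 /=.
by apply: ge_ereal_sup => _ [x Ux [y Uy <-]]; exact: Uc.
Qed.

Lemma hausdorff_delta_ge0 (s delta : RR) (E : set RR) :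
  (0 <= hausdorff_delta s delta E)%E.
Proof.
apply: le_ereal_inf_tmp => _ [U _ <-].
by apply: nneseries_ge0 => k _ _; exact: poweR_ge0.
Qed.

Lemma hausdorff_measure_eq0 (s : RR) (E : set RR) :
  hausdorff_measure s E = 0%E <->
  forall delta : RR, 0 < delta -> hausdorff_delta s delta E = 0%E.
Proof.
split=> [H0 delta d0|H].
  apply/eqP; rewrite eq_le hausdorff_delta_ge0 andbT -H0.
  by apply: ereal_sup_ubound; exists delta.
apply/eqP; rewrite eq_le; apply/andP; split.
  by apply: ge_ereal_sup => _ [d /= d0 <-]; rewrite H.
by rewrite -(H 1 ltr01); apply: ereal_sup_ubound; exists 1 => //=; exact: ltr01.
Qed.

Section expanding.
Variables (F E : set RR) (g : RR -> RR) (C : RR).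
Hypotheses (C0 : 0 < C) (gFE : forall x, F x -> E (g x)).
Hypothesis gC : forall x y, F x -> F y -> `|x - y| <= C * `|g x - g y|.

(** A cover of [E] pulls back along [g] to a cover of [F] whose diameters grow by at most the factor
    [C], hence their [s]-th powers by at most [C ^ s]. *)
Lemma hausdorff_delta_expanding (s delta : RR) : 0 <= s ->
  (hausdorff_delta s (C * delta)%R F <= (C `^ s)%:E * hausdorff_delta s delta E)%E.
Proof.
move=> s0; rewrite muleC -lee_pdivrMr ?powR_gt0//.
apply: le_ereal_inf_tmp => _ [U [EU Ud] <-].
rewrite lee_pdivrMr ?powR_gt0// muleC.
pose V k := F `&` g @^-1` (U k).
have dV k : (diam (V k) <= C%:E * diam (U k))%E.
  apply: diam_le => [|x y [Fx Ux] [Fy Uy]].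
    by rewrite mule_ge0 ?diam_ge0// lee_fin ltW.
  apply: (@le_trans _ _ (C%:E * (`|g x - g y|)%:E)%E).
    by rewrite -EFinM lee_fin; exact: gC.
  by rewrite lee_pmul2l ?lte_fin//; exact: le_diam.
apply: (@le_trans _ _ (\sum_(0 <= k <oo) poweR (diam (V k)) s)%E).
  apply: ereal_inf_lbound; exists V => //; split=> [x Fx|k].
    by have [k _ Uk] := EU _ (gFE Fx); exists k.
  by rewrite (le_trans (dV k))// EFinM lee_pmul2l ?lte_fin.
rewrite -nneseriesZl; last by move=> k _; exact: poweR_ge0.
apply: lee_nneseries => [k _ _|k _]; first exact: poweR_ge0.
rewrite -poweR_EFin -poweRM ?lee_fin ?(ltW C0) ?diam_ge0//.
by rewrite gt0_ler_poweR ?in_itv/= ?diam_ge0 ?leey// mule_ge0 ?diam_ge0// lee_fin ltW.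
Qed.

Lemma hausdorff_dim_expanding : (hausdorff_dim F <= hausdorff_dim E)%E.
Proof.
apply: ereal_inf_le_tmp => _ [s [s0 /hausdorff_measure_eq0 Es] <-].
exists s => //; split=> //; apply/hausdorff_measure_eq0 => d d0.
apply/eqP; rewrite eq_le hausdorff_delta_ge0 andbT.
have := hausdorff_delta_expanding (d / C) s0.
by rewrite Es ?divr_gt0// mule0 mulrC divfK ?gt_eqF.
Qed.

End expanding.

(** * Continued fraction orbits and their separation *)

(** [x n] is the tail [0; a_n, a_(n+1), ...]. The relational form avoids floors, and strict bounds
    at every index make the digits positive and the expansion infinite. *)
Definition cf_orbit (x : nat -> RR) (a : nat -> nat) : Prop :=
  forall n, 0 < x n < 1 /\ (x n)^-1 = (a n)%:R + x n.+1.

Lemma cf_orbit_digit_gt0 (x : nat -> RR) (a : nat -> nat) (n : nat) :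
  cf_orbit x a -> (0 < a n)%N.
Proof.
move=> xa; have [/andP[x0 x1] xV] := xa n; have [/andP[_ y1] _] := xa n.+1.
have : 1 < (x n)^-1 by rewrite invf_gt1.
by rewrite xV; case: (a n) => // ?; lra.
Qed.

(* The pair [(q_(n-1), q_n)] of consecutive continuants of [a_0, ..., a_(n-1)]. *)
Fixpoint continuants (a : nat -> nat) (n : nat) : nat * nat :=
  if n is m.+1 then
    ((continuants a m).2, ((continuants a m).1 + a m * (continuants a m).2)%N)
  else (0%N, 1%N).

Lemma continuants_le (a b : nat -> nat) (n : nat) : (forall i, a i <= b i)%N ->
  ((continuants a n).1 <= (continuants b n).1)%N /\
  ((continuants a n).2 <= (continuants b n).2)%N.
Proof.
move=> ab; elim: n => //= n [IH1 IH2]; split=> //.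
by rewrite leq_add// leq_mul.
Qed.

Section positive_digits.
Variable a : nat -> nat.
Hypothesis a_gt0 : forall i, (0 < a i)%N.

Lemma continuants_gt0 (n : nat) : (0 < (continuants a n).2)%N.
Proof. by elim: n => //= n IH; rewrite ltn_addl// muln_gt0 a_gt0. Qed.

Lemma continuants_nondecreasing (n : nat) :
  ((continuants a n).1 <= (continuants a n).2)%N.
Proof. by case: n => //= n; rewrite (leq_trans _ (leq_addl _ _))// leq_pmull. Qed.

Lemma continuants_ge (n : nat) : (n <= (continuants a n).2)%N.
Proof.
elim: n => // -[|n] IH; first exact: continuants_gt0.
rewrite [continuants a n.+2]/=; rewrite [continuants a n.+1]/= in IH.
have := continuants_gt0 n; have := a_gt0 n.+1.
by move: IH => /=; nia.
Qed.

End positive_digits.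

Section orbit.
Variables (x : nat -> RR) (a : nat -> nat).
Hypothesis xa : cf_orbit x a.

(** Passing from [n] to [n.+1] multiplies the second factor by 1/x_n, because the digit a_n cancels.
    This ties the product of the tails to the inverse of the continuant q_n. *)
Lemma prod_cf_orbit (n : nat) : (\prod_(i < n) x i) *
  ((continuants a n).2%:R + (continuants a n).1%:R * x n) = 1.
Proof.
elim: n => [|n IH]; first by rewrite big_ord0 /=; ring.
rewrite big_ord_recr/= natrD natrM -[RHS]IH -mulrA; congr (_ * _).
have [/andP[x0 _] xV] := xa n.
have -> : x n.+1 = (x n)^-1 - (a n)%:R by rewrite xV; ring.
by field; rewrite gt_eqF.
Qed.

Lemma prod_cf_orbit_gt0 (n : nat) : 0 < \prod_(i < n) x i.
Proof. by apply: prodr_gt0 => i _; case: (xa i) => /andP[]. Qed.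

Lemma prod_cf_orbit_bounds (n : nat) :
  1 <= 2 * (continuants a n).2%:R * \prod_(i < n) x i /\
  (continuants a n).2%:R * \prod_(i < n) x i <= 1.
Proof.
have P0 := prod_cf_orbit_gt0 n; have H := prod_cf_orbit n.
have [/andP[x0 x1] _] := xa n.
have Q1 : (continuants a n).1%:R <= (continuants a n).2%:R :> RR.
  rewrite ler_nat; apply: continuants_nondecreasing => i.
  exact: cf_orbit_digit_gt0 xa.
have Q0 : 0 <= (continuants a n).1%:R :> RR by [].
move: P0 H Q1 Q0; set P := \prod_(i < n) _; set q := _.2%:R; set p := _.1%:R.
move=> P0 H qp p0.
have px0 : 0 <= p * x n by rewrite mulr_ge0// ltW.
have px1 : p * x n <= q by rewrite (le_trans _ qp)// ler_piMr// ltW.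
by split; nra.
Qed.

End orbit.

(** A common digit cancels in 1/x_n - 1/y_n, so x_n - y_n = x_n y_n (y_(n+1) - x_(n+1)), and the
    factors accumulate. *)
Lemma cf_orbit_dist (x y : nat -> RR) (a b : nat -> nat) (n : nat) :
  cf_orbit x a -> cf_orbit y b -> (forall i, (i < n)%N -> a i = b i) ->
  `|x 0%N - y 0%N| = (\prod_(i < n) x i) * (\prod_(i < n) y i) * `|x n - y n|.
Proof.
move=> xa yb; elim: n => [|n IH] ab; first by rewrite !big_ord0 !mul1r.
rewrite IH; last by move=> i /ltnW; exact: ab.
rewrite !big_ord_recr/=.
have [/andP[x0 _] xV] := xa n; have [/andP[y0 _] yV] := yb n.
have -> : x n - y n = x n * y n * (y n.+1 - x n.+1).
  have -> : x n.+1 = (x n)^-1 - (a n)%:R by rewrite xV; ring.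
  have -> : y n.+1 = (y n)^-1 - (a n)%:R by rewrite yV ab//; ring.
  by field; rewrite !gt_eqF.
rewrite !normrM (gtr0_norm x0) (gtr0_norm y0) distrC; ring.
Qed.

(** For n >= 1, sharing n digits bounds the distance by 1/q_n, which is at most 1/n. *)
Lemma cf_orbit_inj (x y : nat -> RR) (a : nat -> nat) :
  cf_orbit x a -> cf_orbit y a -> x 0%N = y 0%N.
Proof.
move=> xa ya; apply/eqP; rewrite -subr_eq0 -normr_le0 leNgt; apply/negP => d0.
have a0 i : (0 < a i)%N by exact: cf_orbit_digit_gt0 xa.
set d := `|_| in d0.
have [n] : exists n : nat, d^-1 < n%:R.
  by exists (Num.truncn d^-1).+1; exact: truncnS_gt.
have dE := @cf_orbit_dist _ _ _ _ n xa ya (fun _ _ => erefl).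
have [_ X] := prod_cf_orbit_bounds xa n.
have [_ Y] := prod_cf_orbit_bounds ya n.
have X0 := prod_cf_orbit_gt0 xa n; have Y0 := prod_cf_orbit_gt0 ya n.
have [/andP[xn0 xn1] _] := xa n; have [/andP[yn0 yn1] _] := ya n.
have D1 : `|x n - y n| <= 1 by rewrite ler_norml; apply/andP; split; lra.
have Qn : n%:R <= (continuants a n).2%:R :> RR.
  by rewrite ler_nat; exact: continuants_ge.
have Q1 : 1 <= (continuants a n).2%:R :> RR.
  by rewrite ler1n; exact: continuants_gt0.
rewrite -div1r ltr_pdivrMr// ltNge => /negP; apply.
move: dE X Y X0 Y0; rewrite -/d; set P := \prod_(i < n) x i; set P' := \prod_(i < n) y i.
move=> dE X Y X0 Y0; set Q := _%:R in X Y Qn Q1.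
have P1 : P <= 1 by rewrite (le_trans _ X)// ler_peMl// ltW.
have d1 : d <= P * P' by rewrite dE ler_piMr// mulr_ge0// ltW.
apply: (@le_trans _ _ (Q * (P * P'))); first by apply: ler_pM => //; exact: ltW.
by rewrite mulrCA mulr_ile1// ?mulr_ge0// ltW.
Qed.

(** If b_0 < c_0 then y_0 - z_0 = y_0 z_0 (c_0 - b_0 + z_1 - y_1), at least y_0 z_0 (1 - y_1); each
    of these three factors is at least 1/(N+2). *)
Lemma cf_orbit_gap (y z : nat -> RR) (b c : nat -> nat) (N : nat) :
  cf_orbit y b -> cf_orbit z c -> (forall i, b i <= N)%N -> (forall i, c i <= N)%N ->
  b 0%N != c 0%N -> 1 <= (N + 2)%:R ^+ 3 * `|y 0%N - z 0%N|.
Proof.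
have lb w d n : cf_orbit w d -> (forall i, d i <= N)%N -> 1 <= (N + 1)%:R * w n.
  move=> wd dN; have [/andP[w0 w1] wV] := wd n; have [/andP[_ v1] _] := wd n.+1.
  rewrite -ler_pdivrMr// div1r wV natrD lerD// ?ler_nat ?ltW// ?dN.
(* From w_(n+1) >= 1/(N+1) and d_n >= 1 follows w_n <= 1/(1 + 1/(N+1)) = (N+1)/(N+2). *)
have ub w d n : cf_orbit w d -> (forall i, d i <= N)%N ->
    1 <= (N + 2)%:R * (1 - w n).
  move=> wd dN; have [/andP[w0 w1] wV] := wd n; have L := lb _ _ n.+1 wd dN.
  have d1 : 1 <= (d n)%:R :> RR by rewrite ler1n; exact: cf_orbit_digit_gt0 wd.
  have wE : w n * ((d n)%:R + w n.+1) = 1 by rewrite -wV mulfV// gt_eqF.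
  have [/andP[v0 v1] _] := wd n.+1.
  have H : w n * (1 + w n.+1) <= 1 by rewrite -[leRHS]wE (ler_wpM2l (ltW w0))// lerD2r.
  move: L; rewrite !natrD; have : 0 <= N%:R :> RR by [].
  move: (N%:R : RR) (w n) (w n.+1) w0 w1 v0 v1 H => M u v *.
  nra.
wlog : y z b c / (b 0 < c 0)%N => [wl yb zc bN cN bc|bc yb zc bN cN _].
  have [lt|lt|e] := ltngtP (b 0%N) (c 0%N).
  - exact: (wl y z b c).
  - by rewrite distrC; apply: (wl z y c b) => //; rewrite eq_sym.
  - by rewrite e eqxx in bc.
have Ly := lb _ _ 0%N yb bN; have Lz := lb _ _ 0%N zc cN.
have U := ub _ _ 1%N yb bN.
have [/andP[y0 y1] yV] := yb 0%N; have [/andP[z0 z1] zV] := zc 0%N.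
have [/andP[u0 u1] _] := yb 1%N; have [/andP[v0 v1] _] := zc 1%N.
have bcR : (b 0%N)%:R + 1 <= (c 0%N)%:R :> RR by rewrite natr1 ler_nat.
have E : y 0%N - z 0%N = y 0%N * z 0%N * ((c 0%N)%:R - (b 0%N)%:R + z 1%N - y 1%N).
  have -> : z 1%N = (z 0%N)^-1 - (c 0%N)%:R by rewrite zV; ring.
  have -> : y 1%N = (y 0%N)^-1 - (b 0%N)%:R by rewrite yV; ring.
  by field; rewrite !gt_eqF.
have N12 : (N + 1)%:R <= (N + 2)%:R :> RR by rewrite ler_nat leq_add2l.
apply: (@le_trans _ _ (((N + 2)%:R * y 0%N) * ((N + 2)%:R * z 0%N) *
   ((N + 2)%:R * (1 - y 1%N)))).
  have h (w : RR) : 0 < w -> 1 <= (N + 1)%:R * w -> 1 <= (N + 2)%:R * w.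
    by move=> w0 w1'; exact: le_trans w1' (ler_wpM2r (ltW w0) N12).
  by apply: mulr_ege1 => //; apply: mulr_ege1; exact: h.
apply: (@le_trans _ _ ((N + 2)%:R ^+ 3 * (y 0%N - z 0%N))); last first.
  by rewrite ler_wpM2l ?exprn_ge0// ler_norm.
rewrite E.
have -> : (N + 2)%:R * y 0%N * ((N + 2)%:R * z 0%N) * ((N + 2)%:R * (1 - y 1%N)) =
  (N + 2)%:R ^+ 3 * (y 0%N * z 0%N * (1 - y 1%N)) by ring.
rewrite ler_wpM2l ?exprn_ge0// ler_wpM2l ?mulr_ge0 ?ltW//.
by lra.
Qed.

(** Such a product lies between 1/(2 q_n) and 1/q_n, and q_n is monotone in the digits. *)
Lemma prod_cf_orbit_le (x y : nat -> RR) (a b : nat -> nat) (n : nat) :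
  cf_orbit x a -> cf_orbit y b -> (forall i, b i <= a i)%N ->
  \prod_(i < n) x i <= 2 * \prod_(i < n) y i.
Proof.
move=> xa yb ba; have [_ ba2] := continuants_le n ba.
have [_ X] := prod_cf_orbit_bounds xa n; have [Y _] := prod_cf_orbit_bounds yb n.
have X0 := prod_cf_orbit_gt0 xa n; have Y0 := prod_cf_orbit_gt0 yb n.
have Q : (continuants b n).2%:R <= (continuants a n).2%:R :> RR by rewrite ler_nat.
move: X Y X0 Y0 Q; set P := \prod_(i < n) x i; set P' := \prod_(i < n) y i.
move: ((continuants a n).2%:R : RR) ((continuants b n).2%:R : RR) => r s X Y X0 Y0 sr.
apply: (@le_trans _ _ (P * (2 * s * P'))); first by rewrite ler_peMr ?(ltW X0).
rewrite (_ : P * _ = 2 * P' * (s * P)); last by ring.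
by rewrite ler_piMr ?mulr_ge0 ?(ltW Y0)// (le_trans _ X)// ler_wpM2r// ltW.
Qed.

Lemma cf_orbit_shift (x : nat -> RR) (a : nat -> nat) (n : nat) : cf_orbit x a ->
  cf_orbit (fun i => x (n + i)%N) (fun i => a (n + i)%N).
Proof. by move=> xa i; rewrite addnS; exact: xa. Qed.

(* Lowering the digits enlarges the cylinders, while the cylinders over digits
   at most [N] stay separated by a fixed proportion of their parent. *)
Lemma cf_orbit_comparison (x x' y y' : nat -> RR) (a a' b b' : nat -> nat) (N : nat) :
  cf_orbit x a -> cf_orbit x' a' -> cf_orbit y b -> cf_orbit y' b' ->
  (forall i, b i <= a i)%N -> (forall i, b' i <= a' i)%N ->
  (forall i, a i <> a' i -> b i <> b' i) -> (forall i, a i = a' i -> b i = b' i) ->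
  (forall i, b i <= N)%N -> (forall i, b' i <= N)%N ->
  `|x 0%N - x' 0%N| <= 4 * (N + 2)%:R ^+ 3 * `|y 0%N - y' 0%N|.
Proof.
move=> xa xa' yb yb' ba ba' ab_neq ab_eq bN bN'.
have [ex|nex] := pselect (exists i, a i != a' i); last first.
  have aE : a = a'.
    by apply/funext => i; apply/eqP/negPn/negP => ai; apply: nex; exists i.
  rewrite -aE in xa'; rewrite (cf_orbit_inj xa xa') subrr normr0.
  by rewrite !mulr_ge0.
(* [n] is the first index where the digits differ: the common prefix contributes products of tails,
   the tails at [n] the gap. *)
case: (ex_minnP ex) => n an min_n.
have a_eq i : (i < n)%N -> a i = a' i.
  by move=> ilt; apply/eqP/negPn/negP => /min_n; rewrite leqNgt ilt.
rewrite (cf_orbit_dist xa xa' a_eq).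
rewrite (cf_orbit_dist yb yb' (fun i ilt => ab_eq i (a_eq i ilt))).
have gap : 1 <= (N + 2)%:R ^+ 3 * `|y n - y' n|.
  have := cf_orbit_gap (cf_orbit_shift n yb) (cf_orbit_shift n yb')
    (fun i => bN (n + i)%N) (fun i => bN' (n + i)%N).
  by rewrite /= !addn0; apply; apply/eqP/ab_neq/eqP.
have [/andP[u0 u1] _] := xa n; have [/andP[v0 v1] _] := xa' n.
have D1 : `|x n - x' n| <= 1 by rewrite ler_norml; apply/andP; split; lra.
have L := prod_cf_orbit_le n xa yb ba; have L' := prod_cf_orbit_le n xa' yb' ba'.
have X0 := prod_cf_orbit_gt0 xa n; have Y0 := prod_cf_orbit_gt0 yb n.
have X0' := prod_cf_orbit_gt0 xa' n; have Y0' := prod_cf_orbit_gt0 yb' n.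
move: L L' X0 X0' Y0 Y0' gap.
set P := \prod_(i < n) x i; set P' := \prod_(i < n) x' i.
set S := \prod_(i < n) y i; set S' := \prod_(i < n) y' i.
move=> L L' X0 X0' Y0 Y0' gap.
apply: (@le_trans _ _ (P * P')); first by rewrite ler_piMr// mulr_ge0// ltW.
(* The constant 4 comes from comparing the two products, each at the cost of a factor 2. *)
apply: (@le_trans _ _ ((2 * S) * (2 * S'))).
  by apply: ler_pM => //; exact: ltW.
have -> : 4 * (N + 2)%:R ^+ 3 * (S * S' * `|y n - y' n|) =
    2 * S * (2 * S') * ((N + 2)%:R ^+ 3 * `|y n - y' n|) by ring.
by rewrite ler_peMr// !mulr_ge0// ltW.
Qed.

(** * Gauss orbits: irrationality, and existence for prescribed digits *)

Lemma cf_orbit_floor (x : nat -> RR) (a : nat -> nat) (n : nat) :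
  cf_orbit x a -> Num.floor (x n)^-1 = a n :> int.
Proof.
move=> xa; have [_ ->] := xa n; have [/andP[y0 y1] _] := xa n.+1.
by apply: floor_def; rewrite intrD -!pmulrn; apply/andP; split; lra.
Qed.

Lemma cf_orbit_gauss (x : nat -> RR) (a : nat -> nat) (n : nat) :
  cf_orbit x a -> iter n gauss (x 0%N) = x n.
Proof.
move=> xa; elim: n => //= n ->; rewrite /gauss (cf_orbit_floor _ xa).
by have [_ ->] := xa n; rewrite -pmulrn addrAC subrr add0r.
Qed.

(** Euclidean descent: if x_0 = p/q then x_1 = (q - a_0 p)/p, a fraction with smaller positive
    numerator, and x_1 starts an orbit again. *)
Lemma cf_orbit_irrational (x : nat -> RR) (a : nat -> nat) :
  cf_orbit x a -> Defs.irrational (x 0%N).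
Proof.
move=> xa r; apply/negP => /eqP xr.
have [p [q [p0 xpq]]] : exists p q : nat, (0 < p)%N /\ x 0%N * q%:R = p%:R.
  have [/andP[x0 _] _] := xa 0%N.
  have r0 : 0 < r by rewrite -(@ltr0q RR) -xr.
  exists `|numq r|%N, `|denq r|%N; split; first by rewrite absz_gt0 numq_eq0 lt0r_neq0.
  rewrite xr !natr_absz !gtr0_norm ?denq_gt0 ?numq_gt0//.
  by rewrite -!(ratr_int RR) -rmorphM -numqE.
elim/ltn_ind: p q x a xa p0 xpq {r xr} => p IH q x a xa p0 xpq.
have [/andP[x0 x1] xV] := xa 0%N; have [/andP[y0 y1] _] := xa 1%N.
have yE : x 1%N * p%:R = q%:R - (a 0%N * p)%:R.
  have -> : x 1%N = (x 0%N)^-1 - (a 0%N)%:R by rewrite xV; ring.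
  by rewrite -xpq natrM -xpq; field; rewrite gt_eqF.
have pR : 0 < p%:R :> RR by rewrite ltr0n.
have apq : (a 0%N * p < q)%N by rewrite -(ltr_nat RR) -subr_gt0 -yE mulr_gt0.
apply: (IH (q - a 0%N * p)%N _ p (fun n => x n.+1) (fun n => a n.+1)).
- by rewrite -(ltr_nat RR) natrB ?(ltnW apq)// -yE gtr_pMl.
- by move=> n; exact: xa.
- by rewrite subn_gt0.
- by rewrite natrB ?(ltnW apq).
Qed.

(* Endpoints of the interval of numbers whose expansion starts with
   [a_0, ..., a_(n-1)]. *)
Fixpoint cf_cylinder (n : nat) (a : nat -> nat) : RR * RR :=
  if n is m.+1 then
    let I := cf_cylinder m (fun i => a i.+1) in
    (((a 0%N)%:R + I.2)^-1, ((a 0%N)%:R + I.1)^-1)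
  else (0, 1).

Lemma cf_cylinderS (n : nat) (a : nat -> nat) : cf_cylinder n.+1 a =
  (((a 0%N)%:R + (cf_cylinder n (fun i => a i.+1)).2)^-1,
   ((a 0%N)%:R + (cf_cylinder n (fun i => a i.+1)).1)^-1).
Proof. by []. Qed.

Lemma cf_cylinder_nested (n : nat) (a : nat -> nat) : (forall i, 0 < a i)%N ->
  [/\ 0 <= (cf_cylinder n a).1, (cf_cylinder n a).1 <= (cf_cylinder n.+1 a).1,
      (cf_cylinder n.+1 a).1 <= (cf_cylinder n.+1 a).2 &
      (cf_cylinder n.+1 a).2 <= (cf_cylinder n a).2].
Proof.
elim: n a => [|n IH] a a0.
  have a1 : 1 <= (a 0%N)%:R :> RR by rewrite ler1n.
  by split; rewrite /= ?addr0 ?invr_ge0 ?lef_pV2 ?invf_le1 ?posrE; lra.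
have a1 : 1 <= (a 0%N)%:R :> RR by rewrite ler1n.
rewrite (cf_cylinderS n.+1 a) (cf_cylinderS n a).
have [] := IH (fun i => a i.+1) (fun i => a0 i.+1).
move: (cf_cylinder n.+1 _) (cf_cylinder n (fun i => a i.+1)) => J I I0 IJ JJ JI.
have pos z : I.1 <= z -> (a 0%N)%:R + z \is Num.pos by rewrite posrE; lra.
by split; rewrite /= ?invr_ge0 ?lef_pV2 ?pos ?lerD2l; lra.
Qed.

Lemma cf_cylinder_point (a : nat -> nat) : (forall i, 0 < a i)%N ->
  exists y, forall n, (cf_cylinder n a).1 <= y <= (cf_cylinder n a).2.
Proof.
move=> a0; have N n := cf_cylinder_nested n a0.
have l_homo : {homo (fun n => (cf_cylinder n a).1) : m n / (m <= n)%N >-> m <= n}.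
  by apply: homo_leq => [//|? ? ?|n]; [exact: le_trans|case: (N n)].
have r_homo : {homo (fun n => (cf_cylinder n a).2) : m n / (m <= n)%N >-> n <= m}.
  by apply: homo_leq => [//|? ? ? yx zy|n]; [exact: le_trans zy yx|case: (N n)].
have lr m n : (cf_cylinder m a).1 <= (cf_cylinder n a).2.
  have [_ _ h _] := N (maxn m n).
  rewrite (le_trans (l_homo m (maxn m n).+1 _))// ?(le_trans h)//.
  - by rewrite leqW ?leq_maxl.
  - by apply: r_homo; rewrite leqW ?leq_maxr.
pose S := [set (cf_cylinder n a).1 | n in [set: nat]].
exists (sup S) => n; apply/andP; split.
  apply: ub_le_sup; last by exists n.
  by exists (cf_cylinder 0 a).2 => _ [m _ <-]; exact: lr.
by apply: ge_sup; [exists (cf_cylinder 0 a).1, 0%N|move=> _ [m _ <-]; exact: lr].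
Qed.

Lemma cf_orbit_exists (a : nat -> nat) : (forall i, 0 < a i)%N ->
  exists x, cf_orbit x a.
Proof.
move=> a0; have [y yP] := cf_cylinder_point a0.
(* Tails are defined by subtracting the prescribed digits; each [x n] stays in every cylinder of the
   shifted digit sequence. *)
pose x := fix x n := if n is m.+1 then (x m)^-1 - (a m)%:R else y.
have xP n k : (cf_cylinder k (fun i => a (n + i)%N)).1 <= x n <=
              (cf_cylinder k (fun i => a (n + i)%N)).2.
  elim: n k => [|n IH] k; first exact: yP.
  have := IH k.+1; rewrite /= addn0.
  have -> : (fun i => a (n + i.+1)%N) = (fun i => a (n.+1 + i)%N).
    by apply/funext => i; rewrite addnS.
  have [] := @cf_cylinder_nested k (fun i => a (n.+1 + i)%N) (fun i => a0 _).
  have a1 : 1 <= (a n)%:R :> RR by rewrite ler1n.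
  move: (cf_cylinder k.+1 _) (cf_cylinder k _) => J I I0 IJ JJ JI.
  move=> /andP[l r].
  have x0 : 0 < x n by rewrite (lt_le_trans _ l)// invr_gt0; lra.
  rewrite lerBrDl lerBlDl; apply/andP; split.
  - by rewrite -[_ + _]invrK lef_pV2 ?posrE ?invr_gt0//; lra.
  - by rewrite -[_ + I.2]invrK lef_pV2 ?posrE ?invr_gt0//; lra.
exists x => n; split; last by rewrite /= addrC subrK.
(* Depth one would only give x_n <= 1 when the digit is 1; depth two makes the bound strict. *)
have := xP n 2; rewrite /= addn0 addn1 addr0.
have a1 : 1 <= (a n)%:R :> RR by rewrite ler1n.
have a2 : 1 <= (a n.+1)%:R :> RR by rewrite ler1n.
have i1 : 0 < (a n.+1)%:R^-1 :> RR by rewrite invr_gt0; lra.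
have i2 : 0 < ((a n.+1)%:R + 1)^-1 :> RR by rewrite invr_gt0; lra.
move=> /andP[l r]; apply/andP; split.
  by rewrite (lt_le_trans _ l)// invr_gt0 addr_gt0//; lra.
by rewrite (le_lt_trans r)// invf_lt1; lra.
Qed.

(** * Monotonicity of the dimension in the alphabet *)

Lemma E_alph_orbit (A : set nat) (x : RR) : (forall a, A a -> (0 < a)%N) ->
  E_alph A x -> exists2 a : nat -> nat, forall n, A (a n) &
  cf_orbit (fun n => iter n gauss x) a.
Proof.
move=> A0 [x01 [_ xA]].
have dA n : A `|cf_digit n x|%N /\ cf_digit n x = `|cf_digit n x|%N%:Z.
  by have [a Aa ->] := xA n; rewrite absz_nat.
exists (fun n => `|cf_digit n x|%N) => [n|n]; first by case: (dA n).
split; last first.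
  rewrite /= /gauss pmulrn -(dA n).2 /cf_digit.
  by rewrite addrC subrK.
(* A vanishing iterate would have digit 0, as the inverse of 0 is 0 by convention; positivity of the
   digits in [A] excludes it. *)
case: n => // n; have := A0 _ (dA n.+1).1; rewrite /cf_digit iterS.
set z := iter n gauss x; rewrite /gauss => d0.
have /andP[l u] := floor_itv z^-1; rewrite intrD in u.
rewrite lt0r subr_ge0 l andbT ltrBlDl u andbT.
by apply/eqP => z0; move: d0; rewrite z0 invr0 floor0.
Qed.

Lemma E_alph_of_orbit (B : set nat) (y : nat -> RR) (b : nat -> nat) :
  cf_orbit y b -> (forall n, B (b n)) -> E_alph B (y 0%N).
Proof.
move=> yb Bb; split; first by case: (yb 0%N).
split; first exact: cf_orbit_irrational yb.
move=> n; exists (b n) => //.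
by rewrite /cf_digit (cf_orbit_gauss _ yb) (cf_orbit_floor _ yb).
Qed.

(** The expanding map sends a point with digits a_n to the point with digits [phi] a_n. *)
Lemma delta_alph_le (A B : set nat) (phi : nat -> nat) :
  finite_set A -> (forall a, A a -> (0 < a)%N) ->
  (forall a, A a -> B (phi a)) -> (forall a, A a -> (0 < phi a <= a)%N) ->
  (forall a a', A a -> A a' -> phi a = phi a' -> a = a') ->
  (delta_alph A <= delta_alph B)%E.
Proof.
move=> finA A0 AB phile phi_inj.
have [N AN] : exists N, forall a, A a -> (a <= N)%N.
  have /finite_seqP[s As] := finA; exists (\max_(i <- s) i)%N => a.
  by rewrite As => /= sa; exact: leq_bigmax_seq.
(* [g] chooses the digits of [x] and an orbit with the replaced digits; its value outside [E_alph A]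
   is arbitrary. *)
have /choice[g gP] : forall x, exists u : (nat -> nat) * (nat -> RR), E_alph A x ->
    [/\ forall n, A (u.1 n), cf_orbit (fun n => iter n gauss x) u.1 &
        cf_orbit u.2 (phi \o u.1)].
  move=> x; have [/(E_alph_orbit A0)[a Aa xa]|nx] := pselect (E_alph A x); last first.
    by exists (fun=> 0%N, fun=> 0).
  have [|y ya] := @cf_orbit_exists (phi \o a); last by exists (a, y).
  by move=> i; have /andP[] := phile _ (Aa i).
apply: (@hausdorff_dim_expanding _ _ (fun x => (g x).2 0%N) (4 * (N + 2)%:R ^+ 3)).
- by rewrite mulr_gt0// exprn_gt0// ltr0n addn2.
- move=> x /gP[Aa _ yb]; apply: E_alph_of_orbit yb _ => n; exact: AB.
- move=> x x' /gP[Aa xa yb] /gP[Aa' xa' yb'].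
  apply: (cf_orbit_comparison xa xa' yb yb') => i /=.
  + by have /andP[] := phile _ (Aa i).
  + by have /andP[] := phile _ (Aa' i).
  + by move=> ne /phi_inj-/(_ (Aa i) (Aa' i)).
  + by move=> ->.
  + by have /andP[_ /leq_trans->//] := phile _ (Aa i); exact: AN.
  + by have /andP[_ /leq_trans->//] := phile _ (Aa' i); exact: AN.
Qed.

Lemma close_digits (A : set nat) : finite_set A -> (forall a, A a -> (0 < a)%N) ->
  (delta_alph A_oct < delta_alph A)%E ->
  exists a d, [/\ A a, A (a + d)%N & (0 < d < 8)%N].
Proof.
move=> finA A0; apply: contraPP => nA; apply/negP; rewrite -leNgt.
have sep a a' : A a -> A a' -> (a < a')%N -> (a + 8 <= a')%N.
  move=> Aa Aa' lt; rewrite leqNgt; apply/negP => lt8; apply: nA.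
  by exists a, (a' - a)%N; rewrite subnKC ?(ltnW lt)//; split=> //; lia.
apply: (@delta_alph_le _ _ (fun a => 8 * (a.-1 %/ 8) + 1)%N) => //.
- by move=> a _; exists (a.-1 %/ 8)%N.
- by move=> a /A0; lia.
- move=> a a' Aa Aa'; have := A0 _ Aa; have := A0 _ Aa'.
  case: (ltngtP a a') => // lt.
    by have := sep _ _ Aa Aa' lt; lia.
  by have := sep _ _ Aa' Aa lt; lia.
Qed.

Lemma one_or_consecutive_digits (A : set nat) :
  finite_set A -> (forall a, A a -> (0 < a)%N) ->
  (delta_alph A_even < delta_alph A)%E ->
  A 1%N \/ exists2 a, A a & A a.+1.
Proof.
move=> finA A0; apply: contraPP => /not_orP[A1 nA]; apply/negP; rewrite -leNgt.
have sep a a' : A a -> A a' -> (a < a')%N -> (a + 2 <= a')%N.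
  move=> Aa Aa' lt; rewrite leqNgt; apply/negP => lt2; apply: nA.
  by exists a => //; rewrite (_ : a.+1 = a')//; lia.
have A2 a : A a -> (1 < a)%N.
  by move=> Aa; have := A0 _ Aa; case: a Aa => [|[]].
apply: (@delta_alph_le _ _ (fun a => 2 * (a %/ 2))%N) => //.
- by move=> a /A2 a2; exists (a %/ 2).-1; lia.
- by move=> a /A2; lia.
- move=> a a' Aa Aa'; have := A2 _ Aa; have := A2 _ Aa'.
  case: (ltngtP a a') => // lt.
    by have := sep _ _ Aa Aa' lt; lia.
  by have := sep _ _ Aa' Aa lt; lia.
Qed.

(** * Denominators modulo [q] *)

Lemma coprime_arith_progression (a b q : nat) : (0 < q)%N -> coprime a b ->
  exists j : nat, coprime q (a + j * b).
Proof.
move=> q0 ab; pose pi : nat_pred := [pred p | ~~ (p %| a)%N].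
exists (q`_pi)%N; rewrite /coprime eqn_leq gcdn_gt0 q0 andbT leqNgt.
apply/negP => g1; have := pdiv_prime g1; have := pdiv_dvd (gcdn q (a + q`_pi * b)).
set p := pdiv _; rewrite dvdn_gcd => /andP[pq pab] pp.
have [pa|pa] := boolP (p %| a)%N.
  move: pab; rewrite dvdn_addr// Euclid_dvdM// => /orP[pj|pb].
    by have := pnat_dvd pj (part_pnat pi q); rewrite pnatE// inE /= pa.
  by have := dvdn_gcd p a b; rewrite pa pb (eqP ab) Euclid_dvd1.
have pj : (p %| q`_pi)%N.
  by rewrite -[p in (p %| _)%N](@part_pnat_id pi) ?partn_dvd// pnatE.
by move: pab; rewrite dvdn_addl ?(negPf pa)// dvdn_mulr.
Qed.

Lemma eq_intr_Zp (q : nat) (m n : int) : (1 < q)%N ->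
  m%:~R = n%:~R :> 'Z_q -> (m = n %[mod q%:Z])%Z.
Proof.
move=> q1 mn; apply/eqP; rewrite eqz_mod_dvd.
have : (m - n)%:~R = 0 :> 'Z_q by rewrite intrB mn subrr.
have nat0 (k : nat) : k%:R = 0 :> 'Z_q -> (q %| k)%N.
  by move=> /(congr1 (@nat_of_ord _)); rewrite val_Zp_nat// => /eqP.
rewrite /dvdz /=; case: (m - n) => k; first exact: nat0.
rewrite NegzE intrN => /eqP; rewrite oppr_eq0 => /eqP; exact: nat0.
Qed.

Definition gamma_prod (s : seq nat) : 'M[int]_2 :=
  foldr (fun a m => gamma a *m m) 1%:M s.

Lemma gamma_prod_rcons (s : seq nat) (a : nat) :
  gamma_prod (rcons s a) = gamma_prod s *m gamma a.
Proof.
rewrite /gamma_prod; elim: s => [|b s IH] /=; first by rewrite mulmx1 mul1mx.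
by rewrite IH mulmxA.
Qed.

Section reach.
Variables (A : set nat) (q : nat).
Hypothesis q_gt1 : (1 < q)%N.

Definition reach (v : 'Z_q * 'Z_q) : Prop := exists s : seq nat,
  [/\ s != [::], forall a, a \in s -> A a &
      v = ((gamma_prod s 1 0)%:~R, (gamma_prod s 1 1)%:~R)].

Definition step (a : nat) (v : 'Z_q * 'Z_q) := (v.2, v.1 + a%:R * v.2).

Definition unstep (a : nat) (v : 'Z_q * 'Z_q) := (v.2 - a%:R * v.1, v.1).

Lemma stepK (a : nat) : cancel (step a) (unstep a).
Proof. by case=> x y; rewrite /step /unstep /= addrK. Qed.

Lemma reach_step (a : nat) (v : 'Z_q * 'Z_q) : A a -> reach v -> reach (step a v).
Proof.
move=> Aa [s [s0 sA ->]]; exists (rcons s a); split.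
- by case: (s).
- by move=> b; rewrite mem_rcons inE => /orP[/eqP->//|]; exact: sA.
- rewrite gamma_prod_rcons !mxE !big_ord_recl !big_ord0 /= !mxE /=.
  rewrite !mulr0 !mulr1 !addr0 !add0r /step /= intrD intrM mulrC.
  by congr (_, _ + _ * _); congr (gamma_prod s _ _)%:~R; exact/val_inj.
Qed.

Lemma reach_iter (a n : nat) (v : 'Z_q * 'Z_q) :
  A a -> reach v -> reach (iter n (step a) v).
Proof. by move=> Aa rv; elim: n => //= n; exact: reach_step. Qed.

(* [step a] permutes a finite set, so its inverse is one of its iterates. *)
Lemma reach_unstep (a : nat) (v : 'Z_q * 'Z_q) : A a -> reach v -> reach (unstep a v).
Proof. by move=> Aa rv; rewrite -(finv_eq_can (@stepK a)); exact: reach_iter. Qed.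

Lemma reach01 (a : nat) : A a -> reach (0, 1).
Proof.
move=> Aa; rewrite -(@stepK a (0, 1)); apply: reach_unstep => //.
exists [:: a]; split=> // [b|]; first by rewrite inE => /eqP ->.
by rewrite /gamma_prod /= mulmx1 !mxE /= /step /= mulr1 add0r.
Qed.

Section two_digits.
Variables a d : nat.
Hypotheses (Aa : A a) (Aad : A (a + d)%N).

Lemma reach_shearr (c x y : 'Z_q) : reach (x, y) -> reach (x, y + c * d%:R * x).
Proof.
rewrite -[c]natr_Zp; move: (c : nat) => k rxy.
elim: k => [|k IH]; first by rewrite !mul0r addr0.
have := reach_step Aad (reach_unstep Aa IH).
rewrite /step /unstep /= natrD -[k.+1]addn1 natrD.
by congr reach; congr (_, _); ring.
Qed.

Lemma reach_shearl (c x y : 'Z_q) : reach (x, y) -> reach (x + c * d%:R * y, y).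
Proof.
rewrite -[c]natr_Zp; move: (c : nat) => k rxy.
elim: k => [|k IH]; first by rewrite !mul0r addr0.
have := reach_unstep Aa (reach_step Aad IH).
rewrite /step /unstep /= natrD -[k.+1]addn1 natrD.
by congr reach; congr (_, _); ring.
Qed.

Lemma unit_coprime_Zp (m n : nat) : coprime m n ->
  exists j : nat, ((m + j * n)%:R : 'Z_q) \is a GRing.unit.
Proof.
move=> /(@coprime_arith_progression _ _ q (ltnW q_gt1))[j cj].
by exists j; rewrite unitZpE.
Qed.

Lemma reach_shift_snd (m n : nat) (k : int) : coprime m (d * n) ->
  reach (m%:R, n%:R) -> exists x, reach (x, (n%:Z + d%:Z * k)%:~R).
Proof.
move=> /unit_coprime_Zp[j]; set u := _%:R => uu rmn.
have ru : reach (u, n%:R).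
  have := reach_shearl j%:R rmn; congr reach; congr (_, _).
  by rewrite /u natrD !natrM mulrA.
exists u; have := reach_shearr (k%:~R / u) ru; congr reach; congr (_, _).
by rewrite intrD intrM mulrAC divrK// mulrC.
Qed.

Lemma reach_shift_fst (m n : nat) (k : int) : coprime n (d * m) ->
  reach (m%:R, n%:R) -> exists x, reach (x, (m%:Z + d%:Z * k)%:~R).
Proof.
move=> /unit_coprime_Zp[j]; set u := _%:R => uu rmn.
have ru : reach (m%:R, u).
  have := reach_shearr j%:R rmn; congr reach; congr (_, _).
  by rewrite /u natrD !natrM mulrA.
have := reach_unstep Aa (reach_shearl (k%:~R / u) ru).
rewrite /unstep /=; set x := _ - _ => rx; exists x; move: rx.
by congr reach; congr (_, _); rewrite intrD intrM mulrAC divrK// mulrC.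
Qed.

End two_digits.

Definition fib_pair (n : nat) : nat * nat :=
  iter n (fun v => (v.2, (v.1 + v.2)%N)) (0%N, 1%N).

Lemma reach_fib_pair (n : nat) : A 1%N -> reach ((fib_pair n).1%:R, (fib_pair n).2%:R).
Proof.
move=> A1; elim: n => [|n IH]; first exact: reach01 A1.
by have := reach_step A1 IH; rewrite /step /= mul1r -natrD.
Qed.

Lemma fib_pair_residues : all (fun d => all (fun r => has (fun n =>
    let: (x, y) := fib_pair n in
    (y %% d == r)%N && coprime x (d * y) || (x %% d == r)%N && coprime y (d * x))
  (iota 0 14)) (iota 0 d)) (iota 1 7).
Proof. by vm_compute. Qed.

Lemma reach_consecutive (a : nat) (t : int) : A a -> A a.+1 ->
  exists x, reach (x, t%:~R).
Proof.
rewrite -addn1 => Aa Aa1.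
have := @reach_shift_snd a 1 Aa Aa1 0 1 (t - 1) isT (reach01 Aa).
by rewrite mul1r addrC subrK.
Qed.

Lemma reach_fib (a d : nat) (t : int) : A 1%N -> A a -> A (a + d)%N ->
  (0 < d < 8)%N -> exists x, reach (x, t%:~R).
Proof.
move=> A1 Aa Aad d8; have d0 : d%:Z != 0 by lia.
pose r := `|(t %% d%:Z)%Z|%N.
have rE : r%:Z = (t %% d%:Z)%Z by rewrite gez0_abs// modz_ge0.
have rd : (r < d)%N by rewrite -ltz_nat rE ltz_mod// .
have /allP/(_ d) := fib_pair_residues; rewrite mem_iota => /(_ d8).
move=> /allP/(_ r); rewrite mem_iota => /(_ rd)/hasP[n _].
have tE (z : nat) : (z %% d)%N = r -> exists k : int, t = z%:Z + d%:Z * k.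
  move=> zr; exists ((t %/ d%:Z)%Z - (z %/ d)%:Z).
  have zE : z%:Z = (z %/ d)%:Z * d%:Z + (z %% d)%:Z by rewrite -PoszM -PoszD -divn_eq.
  by have := divz_eq t d%:Z; rewrite -rE -zr => tE; rewrite {1}tE {1}zE; ring.
have := reach_fib_pair n A1; case: (fib_pair n) => x y /= rxy.
case/orP => /andP[/eqP/tE[k ->] c].
- exact: (reach_shift_snd Aa Aad k c rxy).
- exact: (reach_shift_fst Aa Aad k c rxy).
Qed.

End reach.

Lemma reach_no_local_obstructions (A : set nat) :
  (exists a, A a) ->
  (forall q t, (1 < q)%N -> exists x, @reach A q (x, t%:~R)) ->
  no_local_obstructions A.
Proof.
move=> [a Aa] rA t q; case: q => [//|[_|q _]].
  exists (gamma_prod [:: a] 1 1); last by rewrite !modz1.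
  exists (gamma_prod [:: a]) => //; exists [:: a]; split=> // b.
  by rewrite inE => /eqP ->.
have [x [s [s0 sA [_ tE]]]] := rA q.+2 t isT.
exists (gamma_prod s 1 1); first by exists (gamma_prod s) => //; exists s.
exact: eq_intr_Zp.
Qed.

Theorem theoremB11 (A : set nat) :
  finite_set A -> (forall a, A a -> (0 < a)%N) ->
  (maxe (delta_alph A_oct) (delta_alph A_even) < delta_alph A)%E ->
  no_local_obstructions A.
Proof.
move=> finA A0; rewrite gt_max => /andP[oct even].
have [a [d [Aa Aad d8]]] := close_digits finA A0 oct.
have [A1|[b Ab Ab1]] := one_or_consecutive_digits finA A0 even.
- apply: reach_no_local_obstructions => [|q t q1]; first by exists a.
  exact: (@reach_fib A q q1 a d t).
- apply: reach_no_local_obstructions => [|q t q1]; first by exists b.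
  exact: (@reach_consecutive A q q1 b t).
Qed.
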